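(* Let $R=\begin{pmatrix} A & M\\ N & B\end{pmatrix}$ be a Morita context ring such that $MN$ and $NM$ are nilpotent ideals of $A$ and $B$, respectively. Then $R$ is weakly periodic if and only if both $A$ and $B$ are weakly periodic.
   Context: All rings are associative with identity. A ring is weakly periodic if each of its elements is a sum of a potent element and a nilpotent element (not required to commute), where $e$ is potent if $e^n=e$ for some integer $n\ge 2$. Morita context ring: $A$, $B$ are rings, $M$ is an $(A,B)$-bimodule, $N$ is a $(B,A)$-bimodule, and there are bimodule homomorphisms $\phi: M\otimes_B N\to A$ and $\psi: N\otimes_A M\to B$ such that, writing $mn:=\phi(m\otimes n)$ and $nm:=\psi(n\otimes m)$, one has $(mn)m'=m(nm')$ and $(nm)n'=n(mn')$ for all $m,m'\in M$, $n,n'\in N$. Then the set of matrices $\begin{pmatrix} a & m\\ n & b\end{pmatrix}$ ($a\in A$, $m\in M$, $n\in N$, $b\in B$) is an associative ring under the usual matrix operations, called a Morita context ring. $MN$ denotes the two-sided ideal $\mathrm{Im}\,\phi$ of $A$ and $NM$ the two-sided ideal $\mathrm{Im}\,\psi$ of $B$. *)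

(* Defs.v *)
From HB Require Import structures.
From mathcomp Require Import all_boot all_algebra.
From mathcomp Require Import boolp classical_sets.
From mathcomp Require Import freeg.

Set Implicit Arguments.
Unset Strict Implicit.
Unset Printing Implicit Defensive.

Import GRing.Theory.

Local Open Scope ring_scope.
Local Open Scope classical_set_scope.

Reserved Notation "v *:> b" (at level 40, left associativity).
Reserved Notation "m *t n" (at level 40, left associativity).
Reserved Notation "{ 'bihom' U -> V }"
  (U at level 98, V at level 99, format "{ 'bihom'  U  ->  V }").

(* Rings are pzRingType: associative and unital, the zero ring being allowed. *)

Definition potent (R : pzRingType) (e : R) : Prop :=
  exists2 n : nat, (2 <= n)%N & e ^+ n = e.

Definition nilpotent_elt (R : pzRingType) (f : R) : Prop :=
  exists n : nat, f ^+ n = 0.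

Definition weakly_periodic (R : pzRingType) : Prop :=
  forall x : R, exists e f : R, [/\ potent e, nilpotent_elt f & x = e + f].

Definition two_sided_ideal (R : pzRingType) (I : set R) : Prop :=
  [/\ I 0, forall x y, I x -> I y -> I (x - y)
    & forall r x, I x -> I (r * x) /\ I (x * r)].

(* finite sums of products of an element of I and an element of J *)
Definition ideal_mul (R : pzRingType) (I J : set R) : set R :=
  [set x | exists2 s : seq (R * R),
     (forall p, p \in s -> I p.1 /\ J p.2) & x = \sum_(p <- s) p.1 * p.2].

Definition ideal_exp (R : pzRingType) (I : set R) (k : nat) : set R :=
  iter k (ideal_mul I) setT.

Definition nilpotent_ideal (R : pzRingType) (I : set R) : Prop :=
  two_sided_ideal I /\ exists k : nat, ideal_exp I k = [set 0].

(* The left action is the one of lmodType; [v *:> b] is the right action. *)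
HB.mixin Record Lmodule_isBimodule (A B : pzRingType) (M : Type)
    of GRing.Lmodule A M := {
  ract : M -> B -> M;
  ractA : forall v b c, ract (ract v b) c = ract v (b * c);
  ract1 : forall v, ract v 1 = v;
  ractDl : forall b, {morph ract^~ b : u v / u + v};
  ractDr : forall v, {morph ract v : b c / b + c};
  ractZ : forall a v b, ract (a *: v) b = a *: ract v b
}.

#[short(type="bimodType")]
HB.structure Definition Bimodule (A B : pzRingType) :=
  {M of GRing.Lmodule A M & Lmodule_isBimodule A B M}.

Notation "v *:> b" := (ract v b) : ring_scope.

HB.instance Definition _ (A : pzRingType) :=
  @Lmodule_isBimodule.Build A A A^o (fun v b => (v : A) * b)
    (fun v b c => esym (mulrA v b c)) (@mulr1 A)
    (fun b u v => mulrDl u v b) (@mulrDr A)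
    (fun a v b => esym (mulrA a v b)).

HB.mixin Record isRightLinear (A B : pzRingType) (U V : bimodType A B)
    (f : U -> V) := {
  bihom_ract : forall u b, f (u *:> b) = f u *:> b
}.

HB.structure Definition BimodHom (A B : pzRingType) (U V : bimodType A B) :=
  {f of @GRing.Linear A U V *:%R f & @isRightLinear A B U V f}.

Notation "{ 'bihom' U -> V }" := (@BimodHom.type _ _ U V) : type_scope.

(* The tensor product over B of an (A, B)-bimodule and a (B, C)-bimodule: the
   free abelian group on pairs modulo the subgroup generated by the relators. *)
Section Tensor.
Context {A B C : pzRingType}.
Variables (M : bimodType A B) (N : bimodType B C).

Local Notation F := {freeg (M * N)%type / int}.
Local Notation gen m n := (<< (m, n) >> : F).

Inductive tensor_relator : F -> Prop :=
| TensorAddl m m' n :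
    tensor_relator (gen (m + m') n - (gen m n + gen m' n))
| TensorAddr m n n' :
    tensor_relator (gen m (n + n') - (gen m n + gen m n'))
| TensorBal m b n :
    tensor_relator (gen (m *:> b) n - gen m (b *: n)).

(* the intersection of all subgroups containing the relators *)
Definition tensor_rel : {pred F} := fun x =>
  `[< forall S : set F, S 0 -> (forall y z, S y -> S z -> S (y - z)) ->
        (forall r, tensor_relator r -> S r) -> S x >].

Fact tensor_rel_zmod : zmod_closed tensor_rel.
Proof.
split=> [|x y /asboolP hx /asboolP hy]; apply/asboolP => S S0 SB SR //.
exact: (SB _ _ (hx S S0 SB SR) (hy S S0 SB SR)).
Qed.

HB.instance Definition _ :=
  GRing.isZmodClosed.Build F tensor_rel tensor_rel_zmod.

Definition tensor : Type := Quotient.quot tensor_rel.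
HB.instance Definition _ := GRing.Zmodule.on tensor.

Local Notation piT := (\pi_(Quotient.quot tensor_rel))%qT.

Definition tens (m : M) (n : N) : tensor :=
  piT (gen m n).

Local Notation "m *t n" := (tens m n).

Definition balanced (G : zmodType) (f : M -> N -> G) : Prop :=
  [/\ forall n, {morph f^~ n : m m' / m + m'},
      forall m, {morph f m : n n' / n + n'}
    & forall m b n, f (m *:> b) n = f m (b *: n)].

Let piB (x y : F) : piT (x - y) = piT x - piT y.
Proof. by rewrite !piE. Qed.

Let piD (x y : F) : piT (x + y) = piT x + piT y.
Proof. by rewrite !piE. Qed.

Let pi0 : piT 0 = 0.
Proof. by rewrite -[X in piT X](subrr (0 : F)) piB subrr. Qed.

Let rel_eq (x y : F) : tensor_relator (x - y) -> piT x = piT y.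
Proof.
move=> h; apply/eqP; rewrite -Quotient.idealrBE; apply/asboolP => S S0 SB SR.
exact: SR.
Qed.

Lemma tens_balanced : balanced tens.
Proof.
split=> [n m m'|m n n'|m b n]; rewrite /tens.
- by rewrite -[RHS]piD; apply: rel_eq; constructor.
- by rewrite -[RHS]piD; apply: rel_eq; constructor.
- by apply: rel_eq; constructor.
Qed.

Lemma tensDl n : {morph tens^~ n : m m' / m + m'}.
Proof. by have [h _ _] := tens_balanced; apply: h. Qed.

Lemma tensDr m : {morph tens m : n n' / n + n'}.
Proof. by have [_ h _] := tens_balanced; apply: h. Qed.

Lemma tens_ract m b n : (m *:> b) *t n = m *t (b *: n).
Proof. by have [_ _ h] := tens_balanced; apply: h. Qed.

Section Lift.
Variables (G : zmodType) (f : M -> N -> G).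

(* Meaningful only when f is balanced: see tensor_liftE and tensor_liftD. *)
Definition tensor_lift (t : tensor) : G :=
  fglift (fun p : M * N => f p.1 p.2 : zmodule G)
    (repr (t : Quotient.quot tensor_rel))%qT.

Hypothesis hf : balanced f.

Local Notation lf := (fglift (fun p : M * N => f p.1 p.2 : zmodule G)).

Let lfB (x y : F) : lf (x - y) = lf x - lf y :> G.
Proof. exact: (lift_is_additive (fun p : M * N => f p.1 p.2 : zmodule G)). Qed.

Let lfD (x y : F) : lf (x + y) = lf x + lf y :> G.
Proof.
have lf0 : lf 0 = 0 :> G by rewrite -[X in lf X](subrr (0 : F)) lfB subrr.
have lfN (z : F) : lf (- z) = - lf z :> G by rewrite -sub0r lfB lf0 sub0r.
by rewrite -{1}[y]opprK lfB lfN opprK.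
Qed.

Let lfU m n : lf (gen m n) = f m n.
Proof. by rewrite liftU scale1r. Qed.

Let lf_rel (x : F) : x \in tensor_rel -> lf x = 0 :> G.
Proof.
have [fDl fDr fb] := hf.
move=> /asboolP /(_ [set y : F | lf y = 0 :> G]); apply => /=.
- by rewrite -[X in lf X](subrr (0 : F)) lfB subrr.
- by move=> y z y0 z0; rewrite lfB y0 z0 subrr.
- move=> r [m m' n|m n n'|m b n]; rewrite lfB ?lfD !lfU.
  + by rewrite fDl subrr.
  + by rewrite fDr subrr.
  + by rewrite fb subrr.
Qed.

Let lift_pi (x : F) :
  tensor_lift (piT x) = lf x.
Proof.
apply/eqP; rewrite -subr_eq0 -lfB; apply/eqP; apply: lf_rel.
by rewrite Quotient.idealrBE reprK.
Qed.

Lemma tensor_liftE m n : tensor_lift (m *t n) = f m n.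
Proof. by rewrite /tens lift_pi lfU. Qed.

Lemma tensor_liftD : {morph tensor_lift : s t / s + t}.
Proof.
move=> s t; rewrite -(reprK (s : Quotient.quot tensor_rel)).
by rewrite -(reprK (t : Quotient.quot tensor_rel)) -[X in tensor_lift X]piD
  !lift_pi lfD.
Qed.

End Lift.

Lemma tensor_sum (t : tensor) :
  exists s : seq (M * N), t = \sum_(p <- s) p.1 *t p.2.
Proof.
pose S (t : tensor) := exists s : seq (M * N), t = \sum_(p <- s) p.1 *t p.2.
have S0 : S 0 by exists [::]; rewrite big_nil.
have SD x y : S x -> S y -> S (x + y).
  by move=> [s ->] [s' ->]; exists (s ++ s'); rewrite big_cat.
have t0 n : 0 *t n = 0.
  by apply: (addrI (0 *t n)); rewrite -tensDl !addr0.
have SN x : S x -> S (- x).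
  move=> [s ->]; exists [seq (- p.1, p.2) | p <- s].
  rewrite big_map -sumrN; apply: eq_bigr => p _ /=.
  by apply: (addrI (p.1 *t p.2)); rewrite -tensDl !subrr t0.
rewrite -/(S t) -(reprK (t : Quotient.quot tensor_rel)).
elim/freeg_ind_dom0: (repr _) => [|k x D _ _ ih].
  by rewrite pi0; apply: S0.
rewrite piD; apply: (SD) ih; case: x => m n.
have Snat j : S (piT << j%:Z *g (m, n) >>).
  elim: j => [|j ih].
    by rewrite freegU0; exists [::]; rewrite big_nil pi0.
  rewrite -addn1 PoszD -freegUD piD; apply: (SD) ih _.
  by exists [:: (m, n)]; rewrite big_seq1.
case: k => [j|j]; first exact: Snat.
rewrite NegzE -freegUN -[- _]sub0r piB.
by rewrite pi0 sub0r; apply: SN; apply: Snat.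
Qed.

Lemma tensor_ext (G : zmodType) (f g : tensor -> G) :
  {morph f : s t / s + t} -> {morph g : s t / s + t} ->
  (forall m n, f (m *t n) = g (m *t n)) -> f =1 g.
Proof.
move=> fD gD fg t; have [s ->] := tensor_sum t.
have h0 (h : tensor -> G) : {morph h : s t / s + t} -> h 0 = 0.
  by move=> hD; apply: (addrI (h 0)); rewrite -hD !addr0.
elim: s => [|p s ih]; first by rewrite big_nil !h0.
by rewrite big_cons fD gD fg ih.
Qed.

Definition tensor_scale (a : A) : tensor -> tensor :=
  tensor_lift (fun m n => (a *: m) *t n).
Definition tensor_ract (t : tensor) (c : C) : tensor :=
  tensor_lift (fun m n => m *t (n *:> c)) t.

Let scale_bal a : balanced (fun m n => (a *: m) *t n).
Proof.
split=> [n m m'|m n n'|m b n]; first by rewrite scalerDr tensDl.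
  by rewrite tensDr.
by rewrite -ractZ tens_ract.
Qed.

Let ract_bal c : balanced (fun m n => m *t (n *:> c)).
Proof.
split=> [n m m'|m n n'|m b n]; first by rewrite tensDl.
  by rewrite ractDl tensDr.
by rewrite ractZ tens_ract.
Qed.

Lemma tensor_scaleE a m n : tensor_scale a (m *t n) = (a *: m) *t n.
Proof. exact: (tensor_liftE (scale_bal a)). Qed.

Lemma tensor_ractE m n c : tensor_ract (m *t n) c = m *t (n *:> c).
Proof. exact: (tensor_liftE (ract_bal c)). Qed.

Fact tensor_scaleD a : {morph tensor_scale a : s t / s + t}.
Proof. exact: (tensor_liftD (scale_bal a)). Qed.

Fact tensor_ractDl c : {morph tensor_ract^~ c : s t / s + t}.
Proof. exact: (tensor_liftD (ract_bal c)). Qed.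

Fact tensor_scaleA a b t :
  tensor_scale a (tensor_scale b t) = tensor_scale (a * b) t.
Proof.
apply: (tensor_ext (f := fun t => tensor_scale a (tensor_scale b t))) t
  => [s t|s t|m n]; rewrite ?tensor_scaleD //.
by rewrite !tensor_scaleE scalerA.
Qed.

Fact tensor_scale1 : left_id 1 tensor_scale.
Proof.
apply: tensor_ext => [s t|//|m n]; first by rewrite tensor_scaleD.
by rewrite tensor_scaleE scale1r.
Qed.

Fact tensor_scaleDl t : {morph tensor_scale^~ t : a b / a + b}.
Proof.
move=> a b; apply: (tensor_ext (f := tensor_scale (a + b))
  (g := fun t => tensor_scale a t + tensor_scale b t)) t => [s t|s t|m n].
- by rewrite tensor_scaleD.
- by rewrite !tensor_scaleD addrACA.
- by rewrite !tensor_scaleE scalerDl tensDl.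
Qed.

HB.instance Definition _ := @GRing.Zmodule_isLmodule.Build A tensor
  tensor_scale tensor_scaleA tensor_scale1 tensor_scaleD tensor_scaleDl.

Fact tensor_ractA t b c :
  tensor_ract (tensor_ract t b) c = tensor_ract t (b * c).
Proof.
apply: (tensor_ext (f := fun t => tensor_ract (tensor_ract t b) c)
  (g := tensor_ract^~ (b * c))) t => [s t|s t|m n]; rewrite ?tensor_ractDl //.
by rewrite !tensor_ractE ractA.
Qed.

Fact tensor_ract1 t : tensor_ract t 1 = t.
Proof.
apply: (tensor_ext (f := tensor_ract^~ 1) (g := id)) t => [s t|//|m n].
  by rewrite tensor_ractDl.
by rewrite tensor_ractE ract1.
Qed.

Fact tensor_ractDr t : {morph tensor_ract t : b c / b + c}.
Proof.
move=> b c; apply: (tensor_ext (f := tensor_ract^~ (b + c))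
  (g := fun t => tensor_ract t b + tensor_ract t c)) t => [s t|s t|m n].
- by rewrite tensor_ractDl.
- by rewrite !tensor_ractDl addrACA.
- by rewrite !tensor_ractE ractDr tensDr.
Qed.

Fact tensor_ractZ a t c :
  tensor_ract (tensor_scale a t) c = tensor_scale a (tensor_ract t c).
Proof.
apply: (tensor_ext (f := fun t => tensor_ract (tensor_scale a t) c)
  (g := fun t => tensor_scale a (tensor_ract t c))) t => [s t|s t|m n].
- by rewrite tensor_scaleD tensor_ractDl.
- by rewrite tensor_ractDl tensor_scaleD.
- by rewrite tensor_scaleE !tensor_ractE tensor_scaleE.
Qed.

HB.instance Definition _ := @Lmodule_isBimodule.Build A C tensor
  tensor_ract tensor_ractA tensor_ract1 tensor_ractDl tensor_ractDr
  tensor_ractZ.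

End Tensor.

Notation "m *t n" := (tens m n) : ring_scope.

Record moritaContext (A B : pzRingType) (M : bimodType A B)
    (N : bimodType B A) := MoritaContext {
  mc_phi : {bihom tensor M N -> A^o};
  mc_psi : {bihom tensor N M -> B^o};
  mc_assocM : forall (m : M) (n : N) (m' : M),
    (mc_phi (m *t n) : A) *: m' = m *:> (mc_psi (n *t m') : B);
  mc_assocN : forall (n : N) (m : M) (n' : N),
    (mc_psi (n *t m) : B) *: n' = n *:> (mc_phi (m *t n') : A)
}.

Section MoritaRing.
Context {A B : pzRingType} {M : bimodType A B} {N : bimodType B A}.

Definition MNideal (C : moritaContext M N) : set A := range (mc_phi C).
Definition NMideal (C : moritaContext M N) : set B := range (mc_psi C).

Fact MNideal_ideal (C : moritaContext M N) : two_sided_ideal (MNideal C).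
Proof.
split=> [|_ _ [s _ <-] [t _ <-]|r _ [t _ <-]].
- by exists 0 => //; rewrite raddf0.
- by exists (s - t) => //; rewrite raddfB.
- split; first by exists (r *: t) => //; rewrite linearZ.
  by exists (t *:> r) => //; rewrite bihom_ract.
Qed.

Fact NMideal_ideal (C : moritaContext M N) : two_sided_ideal (NMideal C).
Proof.
split=> [|_ _ [s _ <-] [t _ <-]|r _ [t _ <-]].
- by exists 0 => //; rewrite raddf0.
- by exists (s - t) => //; rewrite raddfB.
- split; first by exists (r *: t) => //; rewrite linearZ.
  by exists (t *:> r) => //; rewrite bihom_ract.
Qed.

(* ul, ur, dl, dr: upper left, upper right, lower left, lower right entry. *)
Record moritaRing (C : moritaContext M N) := MoritaMx {
  mx_ul : A; mx_ur : M; mx_dl : N; mx_dr : B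
}.

Variable C : moritaContext M N.
Local Notation R := (moritaRing C).
Local Notation mn m n := (mc_phi C (m *t n) : A).
Local Notation nm n m := (mc_psi C (n *t m) : B).

Let to_prod (x : R) : A * M * N * B := (mx_ul x, mx_ur x, mx_dl x, mx_dr x).
Let of_prod (p : A * M * N * B) : R :=
  let: (a, m, n, b) := p in MoritaMx C a m n b.
Let to_prodK : cancel to_prod of_prod. Proof. by case. Qed.

HB.instance Definition _ := Choice.copy R (can_type to_prodK).

Definition morita_zero : R := MoritaMx C 0 0 0 0.
Definition morita_opp (x : R) : R :=
  MoritaMx C (- mx_ul x) (- mx_ur x) (- mx_dl x) (- mx_dr x).
Definition morita_add (x y : R) : R :=
  MoritaMx C (mx_ul x + mx_ul y) (mx_ur x + mx_ur y)
             (mx_dl x + mx_dl y) (mx_dr x + mx_dr y).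
Definition morita_one : R := MoritaMx C 1 0 0 1.
Definition morita_mul (x y : R) : R :=
  let: MoritaMx a m n b := x in let: MoritaMx a' m' n' b' := y in
  MoritaMx C (a * a' + mn m n') (a *: m' + m *:> b')
             (n *:> a' + b *: n') (nm n m' + b * b').

Fact morita_addA : associative morita_add.
Proof. by move=> x y z; rewrite /morita_add /= !addrA. Qed.

Fact morita_addC : commutative morita_add.
Proof.
move=> x y; rewrite /morita_add.
by congr MoritaMx; rewrite addrC.
Qed.

Fact morita_add0 : left_id morita_zero morita_add.
Proof. by case=> a m n b; rewrite /morita_add /= !add0r. Qed.

Fact morita_addN : left_inverse morita_zero morita_opp morita_add.
Proof. by case=> a m n b; rewrite /morita_add /= !addNr. Qed.

HB.instance Definition _ :=
  GRing.isZmodule.Build R morita_addA morita_addC morita_add0 morita_addN.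

Let ract0 (A' B' : pzRingType) (V : bimodType A' B') (v : V) :
  v *:> (0 : B') = 0.
Proof. by apply: (addrI (v *:> (0 : B'))); rewrite -ractDr !addr0. Qed.

Let r0act (A' B' : pzRingType) (V : bimodType A' B') (b : B') :
  (0 : V) *:> b = 0.
Proof. by apply: (addrI ((0 : V) *:> b)); rewrite -ractDl !addr0. Qed.

Let t0 (A' B' C' : pzRingType) (U : bimodType A' B') (V : bimodType B' C')
  (u : U) : u *t (0 : V) = 0.
Proof. by apply: (addrI (u *t (0 : V))); rewrite -tensDr !addr0. Qed.

Let t0l (A' B' C' : pzRingType) (U : bimodType A' B') (V : bimodType B' C')
  (v : V) : (0 : U) *t v = 0.
Proof. by apply: (addrI ((0 : U) *t v)); rewrite -tensDl !addr0. Qed.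

Let mnDl m m' n : mn (m + m') n = mn m n + mn m' n.
Proof. by rewrite tensDl raddfD. Qed.
Let mnDr m n n' : mn m (n + n') = mn m n + mn m n'.
Proof. by rewrite tensDr raddfD. Qed.
Let mnZ a m n : mn (a *: m) n = a * mn m n.
Proof. by rewrite -tensor_scaleE [LHS]linearZ. Qed.
Let mnR m n a : mn m (n *:> a) = mn m n * a.
Proof. by rewrite -tensor_ractE [LHS]bihom_ract. Qed.
Let nmDl n n' m : nm (n + n') m = nm n m + nm n' m.
Proof. by rewrite tensDl raddfD. Qed.
Let nmDr n m m' : nm n (m + m') = nm n m + nm n m'.
Proof. by rewrite tensDr raddfD. Qed.
Let nmZ b n m : nm (b *: n) m = b * nm n m.
Proof. by rewrite -tensor_scaleE [LHS]linearZ. Qed.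
Let nmR n m b : nm n (m *:> b) = nm n m * b.
Proof. by rewrite -tensor_ractE [LHS]bihom_ract. Qed.

Fact morita_mulA : associative morita_mul.
Proof.
case=> a m n b [a' m' n' b'] [a'' m'' n'' b'']; rewrite /morita_mul.
congr MoritaMx.
- rewrite !mulrDl !mulrDr !mnDl !mnDr mnZ mnR tens_ract !mulrA !addrA.
  by rewrite -!addrA; congr (_ + _); rewrite addrCA.
- rewrite !scalerDr !scalerDl !ractDl !ractDr scalerA ractZ ractA mc_assocM.
  by rewrite -!addrA; congr (_ + _); rewrite addrCA.
- rewrite !scalerDr !scalerDl !ractDl !ractDr scalerA ractZ ractA mc_assocN.
  by rewrite -!addrA; congr (_ + _); rewrite addrCA.
- rewrite !mulrDl !mulrDr !nmDl !nmDr nmZ nmR tens_ract !mulrA.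
  by rewrite -!addrA; congr (_ + _); rewrite addrCA.
Qed.

Fact morita_mul1l : left_id morita_one morita_mul.
Proof.
case=> a m n b; rewrite /morita_mul /morita_one.
by rewrite !mul1r !scale1r !r0act !t0l !raddf0 !add0r !addr0.
Qed.

Fact morita_mul1r : right_id morita_one morita_mul.
Proof.
case=> a m n b; rewrite /morita_mul /morita_one.
by rewrite !mulr1 !scaler0 !ract1 !t0 !raddf0 !add0r !addr0.
Qed.

Fact morita_mulDl : left_distributive morita_mul +%R.
Proof.
case=> a m n b [a' m' n' b'] [a'' m'' n'' b'']; rewrite /morita_mul /=.
congr MoritaMx.
- by rewrite mulrDl mnDl addrACA.
- by rewrite scalerDl ractDl addrACA.
- by rewrite scalerDl ractDl addrACA.
- by rewrite mulrDl nmDl addrACA.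
Qed.

Fact morita_mulDr : right_distributive morita_mul +%R.
Proof.
case=> a m n b [a' m' n' b'] [a'' m'' n'' b'']; rewrite /morita_mul /=.
congr MoritaMx.
- by rewrite mulrDr mnDr addrACA.
- by rewrite scalerDr ractDr addrACA.
- by rewrite scalerDr ractDr addrACA.
- by rewrite mulrDr nmDr addrACA.
Qed.

HB.instance Definition _ := GRing.Zmodule_isPzRing.Build R
  morita_mulA morita_mul1l morita_mul1r morita_mulDl morita_mulDr.

End MoritaRing.

(* Main.v *)
(* Modulo the matrices with diagonal entries in MN and NM, the Morita ring is
   A x B, and those matrices are nilpotent: each is a sum of products of
   off-diagonal matrices, and a product of 2k off-diagonal matrices is diagonal
   with entries in (MN)^k and (NM)^k.  Hence diag(e, e') + nilpotent decomposes
   a matrix when e, e' are the potent parts of its diagonal entries.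
   Conversely, the diagonal entries of a potent matrix are potent only modulo
   MN and NM and must be lifted.  Decomposing 2 = e + f in a weakly periodic
   ring shows that 2^n - 2 is nilpotent, so the characteristic is positive; an
   element e with e^n - e nilpotent then has eventually periodic powers, with a
   period divisible by n - 1, and a suitable power of e is potent and congruent
   to e. *)
Require Import Defs.
From HB Require Import structures.
From mathcomp Require Import all_boot all_algebra.
From mathcomp Require Import boolp classical_sets.
From mathcomp Require Import zify.

Import GRing.Theory.
Set Implicit Arguments.
Unset Strict Implicit.
Unset Printing Implicit Defensive.

Local Open Scope ring_scope.
Local Open Scope classical_set_scope.

(** * Two-sided ideals and nilpotence *)

Lemma two_sided_ideal0 (R : pzRingType) (I : set R) : two_sided_ideal I -> I 0.
Proof. by case. Qed.

Lemma two_sided_idealB (R : pzRingType) (I : set R) (x y : R) :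
  two_sided_ideal I -> I x -> I y -> I (x - y).
Proof. by case=> _ h _; apply: h. Qed.

Lemma two_sided_idealD (R : pzRingType) (I : set R) (x y : R) :
  two_sided_ideal I -> I x -> I y -> I (x + y).
Proof.
move=> [I0 IB _] Ix Iy; rewrite -[y]opprK; apply: (IB) => //.
by rewrite -sub0r; apply: IB.
Qed.

Lemma two_sided_idealMl (R : pzRingType) (I : set R) (r x : R) :
  two_sided_ideal I -> I x -> I (r * x).
Proof. by case=> _ _ h /(h r)[]. Qed.

Lemma two_sided_idealMr (R : pzRingType) (I : set R) (r x : R) :
  two_sided_ideal I -> I x -> I (x * r).
Proof. by case=> _ _ h /(h r)[]. Qed.

Lemma two_sided_ideal_subC (R : pzRingType) (I : set R) (x y : R) :
  two_sided_ideal I -> I (x - y) -> I (y - x).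
Proof.
move=> hI Ixy; rewrite -opprB -sub0r.
by apply: two_sided_idealB => //; apply: two_sided_ideal0.
Qed.

Lemma ideal_exp_zero_leq (R : pzRingType) (I : set R) (k l : nat) :
  (k <= l)%N -> ideal_exp I k = [set 0] ->
  forall x, ideal_exp I l x -> x = 0.
Proof.
move=> kl Ik0; rewrite -(subnKC kl); elim: (l - k)%N => [|d IH] x.
  by rewrite addn0 Ik0.
rewrite addnS => -[s sI ->]; rewrite big_seq big1 // => p /sI [_ /IH ->].
by rewrite mulr0.
Qed.

Lemma ideal_exp_cons (R : pzRingType) (I : set R) (k : nat) (x y : R) :
  I x -> ideal_exp I k y -> ideal_exp I k.+1 (x * y).
Proof.
move=> Ix Iy; exists [:: (x, y)]; last by rewrite big_seq1.
by move=> p; rewrite inE => /eqP ->.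
Qed.

Lemma nilpotent_ideal_nil (R : pzRingType) (I : set R) (x : R) :
  nilpotent_ideal I -> I x -> nilpotent_elt x.
Proof.
move=> [_ [k Ik0]] Ix; exists k; apply: (ideal_exp_zero_leq (leqnn k) Ik0).
by elim: {Ik0} k => [//|k IH]; rewrite exprS; apply: ideal_exp_cons.
Qed.

Lemma nilpotent_elt_mod (R : pzRingType) (I : set R) (x : R) (n : nat) :
  (forall y, I y -> nilpotent_elt y) -> I (x ^+ n) -> nilpotent_elt x.
Proof. by move=> nilI /nilI [k hk]; exists (n * k)%N; rewrite exprM. Qed.

(** * Potent elements, positive characteristic and lifting modulo a nil ideal *)

Lemma potent_expr_add (R : pzRingType) (e : R) (n d : nat) :
  e ^+ n.+1 = e -> e ^+ (n * d).+1 = e.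
Proof.
move=> he; elim: d => [|d IH]; first by rewrite muln0 expr1.
by rewrite mulnS -addnS exprD IH -exprSr.
Qed.

Lemma weakly_periodic_char (R : pzRingType) :
  weakly_periodic R -> exists2 m : nat, (0 < m)%N & m%:R = 0 :> R.
Proof.
move=> /(_ 2%:R) [e] [f] [[n n2 en] [j fj] ef].
exists ((2 ^ n - 2) ^ j)%N.
  by rewrite expn_gt0 subn_gt0 -{1}(expn1 2) ltn_exp2l // n2.
have fE : f = 2%:R - e by rewrite ef [e + f]addrC addrK.
have ce : GRing.comm e 2%:R by exact: commr_nat.
have cf : GRing.comm f e by rewrite fE; apply/commr_sym/commrB.
(* Since [e ^+ n = e], 2^n - 2 = (2^n - e^n) - (2 - e) = f c, where [c] is the cofactor of 2 - e in
   2^n - e^n, minus 1. As [f] and [c] commute, the j-th power contains the factor f^j = 0. *)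
pose c := \sum_(i < n) 2%:R ^+ (n.-1 - i) * e ^+ i - 1.
have cfc : GRing.comm f c.
  apply: commrB; last exact: commr1.
  apply: commr_sum => i _; apply: commrM; last exact: commrX.
  by apply: commrX; apply: commr_nat.
have -> : ((2 ^ n - 2) ^ j)%:R = (f * c) ^+ j :> R.
  rewrite natrX natrB; last by rewrite -{1}(expn1 2) leq_exp2l // ltnW.
  congr (_ ^+ j); rewrite /c mulrBr mulr1 {1}fE.
  by rewrite -(subrXX_comm n (commr_sym ce)) en fE opprB addrA subrK -natrX.
by rewrite exprMn_comm // fj mul0r.
Qed.

(** From (i+1) C(m t!, i+1) = m t! C(m t! - 1, i), the factor i+1 cancels against t!, leaving [m]
    untouched. *)
Lemma dvdn_bin_fact (m t i : nat) :
  (i < t)%N -> (m %| 'C(m * t`!, i.+1))%N.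
Proof.
move=> it; have /dvdnP[q tE] : (i.+1 %| t`!)%N by rewrite dvdn_fact.
apply/dvdnP; exists (q * 'C((m * t`!).-1, i))%N; apply/eqP.
rewrite -(eqn_pmul2l (ltn0Sn i)) -mul_bin_diag [in X in (X * _)%N]tE.
by apply/eqP; lia.
Qed.

(* Writing e^k = 1 + g, the binomial expansion of (1 + g)^(m t!) reduces to 1
   modulo g^t, since m divides the coefficients of g, ..., g^(t-1). *)
Lemma char_eventually_periodic (R : pzRingType) (m k t : nat) (e : R) :
  m%:R = 0 :> R -> (e ^+ k.+1 - e) ^+ t = 0 ->
  e ^+ (t + k * (m * t`!)) = e ^+ t.
Proof.
move=> m0; pose g := e ^+ k - 1.
have ceg : GRing.comm e g by apply: commrB; [exact: commrX | exact: commr1].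
have -> : e ^+ k.+1 - e = e * g by rewrite /g mulrBr mulr1 exprS.
rewrite exprMn_comm // => eg0.
rewrite exprD exprM -[e ^+ k](subrK 1) -/g exprD1n big_ord_recl expr0 bin0.
rewrite mulr1n mulrDr mulr1 mulr_sumr big1 ?addr0 // => i _.
rewrite lift0; have [it|ti] := ltnP i t.
  have /dvdnP[q ->] := dvdn_bin_fact m it.
  by rewrite mulrnA -mulr_natr m0 !mulr0.
by rewrite -(subnKC (leqW ti)) exprD mulrnAr mulrA eg0 mul0r mul0rn.
Qed.

Lemma ideal_subX (R : pzRingType) (I : set R) (x y : R) (n : nat) :
  two_sided_ideal I -> I (x - y) -> I (x ^+ n - y ^+ n).
Proof.
move=> hI Ixy; elim: n => [|n IH]; first by rewrite subrr; apply: two_sided_ideal0.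
have -> : x ^+ n.+1 - y ^+ n.+1 = (x - y) * x ^+ n + y * (x ^+ n - y ^+ n).
  by rewrite !exprS mulrBl mulrBr addrA subrK.
apply: two_sided_idealD => //; first exact: two_sided_idealMr.
exact: two_sided_idealMl.
Qed.

Lemma potent_lift (R : pzRingType) (I : set R) (m n : nat) (e : R) :
  two_sided_ideal I -> (forall x, I x -> nilpotent_elt x) ->
  (0 < m)%N -> m%:R = 0 :> R -> (2 <= n)%N -> I (e ^+ n - e) ->
  exists2 e1 : R, potent e1 & I (e1 - e).
Proof.
case: n => [|[|k]] // hI nilI m_gt0 m0 _ Ie.
have [t et0] := nilI _ Ie.
have period := char_eventually_periodic m0 et0.
set p := (k.+1 * _)%N in period.
have p_gt0 : (0 < p)%N by rewrite !muln_gt0 m_gt0 fact_gt0.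
have period1 s : (t <= s)%N -> e ^+ (s + p) = e ^+ s.
  by move=> /subnK <-; rewrite -addnA exprD period -exprD.
have periodM s l : (t <= s)%N -> e ^+ (s + l * p) = e ^+ s.
  move=> ts; elim: l => [|l IH]; first by rewrite addn0.
  by rewrite mulSnr addnA period1 // (leq_trans ts) ?leq_addr.
(* With q = (t+1) p, the exponents (q+1)^2 and q+1 differ by a multiple of the period [p], and q+1
   is past [t], where periodicity starts; so the power is potent. As n - 1 = [k.+1] divides [p], it
   is congruent to [e] modulo [I]. *)
exists (e ^+ (t.+1 * p).+1).
  exists (t.+1 * p).+1; first by rewrite ltnS muln_gt0.
  rewrite -exprM mulnS mulnA periodM //.
  by rewrite (leq_trans (leqnSn t)) // leqW // leq_pmulr.
have Iexp d : I (e ^+ (k.+1 * d).+1 - e).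
  elim: d => [|d IH]; first by rewrite muln0 expr1 subrr; apply: two_sided_ideal0.
  rewrite mulnS -addnS addnC.
  have -> : e ^+ ((k.+1 * d).+1 + k.+1) - e =
            (e ^+ (k.+1 * d).+1 - e) * e ^+ k.+1 + (e ^+ k.+2 - e).
    by rewrite mulrBl -exprD -exprS addrA subrK.
  by apply: two_sided_idealD => //; apply: two_sided_idealMr.
by rewrite /p mulnCA; apply: Iexp.
Qed.

(** * Maps that are multiplicative modulo an ideal *)

Lemma expr_morph_mod (R A : pzRingType) (I : set A) (pi : R -> A) (x : R)
    (n : nat) :
  two_sided_ideal I -> pi 1 = 1 ->
  (forall x y, I (pi (x * y) - pi x * pi y)) -> I (pi (x ^+ n) - pi x ^+ n).
Proof.
move=> hI pi1 piM; elim: n => [|n IH].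
  by rewrite pi1 subrr; apply: two_sided_ideal0.
have -> : pi (x ^+ n.+1) - pi x ^+ n.+1 =
    (pi (x * x ^+ n) - pi x * pi (x ^+ n)) + pi x * (pi (x ^+ n) - pi x ^+ n).
  by rewrite !exprS mulrBr addrA subrK.
by apply: two_sided_idealD => //; apply: two_sided_idealMl.
Qed.

(** Meant for the two diagonal-entry maps. The image of a potent [e] is potent only modulo [I] and
    is replaced by a lift [e1]; the remainder is then congruent to [pi f] modulo [I], so one of its
    powers lies in the nil ideal [I]. *)
Lemma weakly_periodic_image (R A : pzRingType) (I : set A) (pi : R -> A) :
  nilpotent_ideal I -> {morph pi : x y / x + y} -> pi 1 = 1 ->
  (forall x y, I (pi (x * y) - pi x * pi y)) ->
  (forall a, exists x, pi x = a) ->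
  weakly_periodic R -> weakly_periodic A.
Proof.
move=> nI piD pi1 piM pi_surj wpR a.
have hI := nI.1; have nilI x := @nilpotent_ideal_nil _ _ x nI.
have piX x n := expr_morph_mod x n hI pi1 piM.
have pi0 : pi 0 = 0 by apply: (addrI (pi 0)); rewrite -piD !addr0.
have [m m_gt0 m0] := weakly_periodic_char wpR.
have mA0 : m%:R = 0 :> A.
  rewrite -pi0 -m0; elim: (m) => [//|l IH].
  by rewrite !mulrS piD pi1 IH.
have [x <-] := pi_surj a; have [e [f [[n n2 en] [j fj] ->]]] := wpR x.
have Ie : I (pi e ^+ n - pi e).
  by apply: two_sided_ideal_subC => //; rewrite -{1}en.
have [e1 pe1 Ie1] := potent_lift hI nilI m_gt0 mA0 n2 Ie.
exists e1, (pi (e + f) - e1); split=> //; last by rewrite [RHS]addrC subrK.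
apply: (nilpotent_elt_mod (n := j) nilI).
rewrite -[X in I X](subrK (pi f ^+ j)); apply: two_sided_idealD => //.
  apply: ideal_subX => //; rewrite piD addrAC addrK.
  exact: two_sided_ideal_subC.
by have /(two_sided_ideal_subC hI) := piX f j; rewrite fj pi0 subr0.
Qed.

(** * Sums of long words *)

(** Lengths are bounded below rather than fixed, so that the spans decrease with [n] and level 1
    admits words of mixed lengths. *)
Inductive word_span (R : pzRingType) (P : set R) (n : nat) : R -> Prop :=
| WordSpan0 : word_span P n 0
| WordSpanD x y : word_span P n x -> word_span P n y -> word_span P n (x + y)
| WordSpanProd (l : seq R) : (forall x, x \in l -> P x) -> (n <= size l)%N ->
    word_span P n (\prod_(x <- l) x).

Lemma word_span_mul (R : pzRingType) (P : set R) (s t : nat) (x y : R) :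
  word_span P s x -> word_span P t y -> word_span P (s + t) (x * y).
Proof.
move=> Wx Wy; elim: Wx => [|x1 x2 _ W1 _ W2|l lP sl].
- by rewrite mul0r; constructor.
- by rewrite mulrDl; constructor.
elim: Wy => [|y1 y2 _ W1 _ W2|l' lP' tl'].
- by rewrite mulr0; constructor.
- by rewrite mulrDr; constructor.
rewrite -big_cat /=; constructor; last by rewrite size_cat leq_add.
by move=> z; rewrite mem_cat => /orP[/lP|/lP'].
Qed.

Lemma word_span_expr (R : pzRingType) (P : set R) (n : nat) (x : R) :
  word_span P 1 x -> word_span P n (x ^+ n).
Proof.
move=> Wx; elim: n => [|n IH]; last by rewrite exprS -add1n; apply: word_span_mul.
by have := @WordSpanProd R P 0 [::]; rewrite big_nil; apply.
Qed.

Lemma word_span_gen (R : pzRingType) (P : set R) (x : R) :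
  P x -> word_span P 1 x.
Proof.
move=> Px; have := @WordSpanProd R P 1 [:: x]; rewrite big_seq1; apply=> // y.
by rewrite inE => /eqP ->.
Qed.

Lemma word_span_leq (R : pzRingType) (P : set R) (s t : nat) (x : R) :
  (s <= t)%N -> word_span P t x -> word_span P s x.
Proof.
move=> st; elim=> [|x1 x2 _ W1 _ W2|l lP tl]; constructor=> //.
exact: leq_trans tl.
Qed.

Lemma word_span_zero (R : pzRingType) (P : set R) (n : nat) (x : R) :
  (forall l : seq R, (forall y, y \in l -> P y) -> (n <= size l)%N ->
     \prod_(y <- l) y = 0) ->
  word_span P n x -> x = 0.
Proof.
move=> prod0; elim=> [//|x1 x2 _ -> _ ->|l lP nl]; first by rewrite addr0.
exact: prod0.
Qed.

(** * Computation in the Morita ring *)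

Lemma ractx0 (A B : pzRingType) (V : bimodType A B) (v : V) : v *:> (0 : B) = 0.
Proof. by apply: (addrI (v *:> (0 : B))); rewrite -ractDr !addr0. Qed.

Lemma ract0x (A B : pzRingType) (V : bimodType A B) (b : B) : (0 : V) *:> b = 0.
Proof. by apply: (addrI ((0 : V) *:> b)); rewrite -ractDl !addr0. Qed.

Lemma tens0r (A B D : pzRingType) (U : bimodType A B) (V : bimodType B D)
  (u : U) : u *t (0 : V) = 0.
Proof. by apply: (addrI (u *t (0 : V))); rewrite -tensDr !addr0. Qed.

Lemma tens0l (A B D : pzRingType) (U : bimodType A B) (V : bimodType B D)
  (v : V) : (0 : U) *t v = 0.
Proof. by apply: (addrI ((0 : U) *t v)); rewrite -tensDl !addr0. Qed.

Lemma moritaME (A B : pzRingType) (M : bimodType A B) (N : bimodType B A)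
    (C : moritaContext M N) (a a' : A) (m m' : M) (n n' : N) (b b' : B) :
  MoritaMx C a m n b * MoritaMx C a' m' n' b' =
  MoritaMx C (a * a' + mc_phi C (m *t n')) (a *: m' + m *:> b')
    (n *:> a' + b *: n') (mc_psi C (n *t m') + b * b').
Proof. by []. Qed.

Lemma moritaDE (A B : pzRingType) (M : bimodType A B) (N : bimodType B A)
    (C : moritaContext M N) (a a' : A) (m m' : M) (n n' : N) (b b' : B) :
  MoritaMx C a m n b + MoritaMx C a' m' n' b' =
  MoritaMx C (a + a') (m + m') (n + n') (b + b').
Proof. by []. Qed.

Lemma morita_diagX (A B : pzRingType) (M : bimodType A B) (N : bimodType B A)
    (C : moritaContext M N) (a : A) (b : B) (n : nat) :
  MoritaMx C a 0 0 b ^+ n = MoritaMx C (a ^+ n) 0 0 (b ^+ n).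
Proof.
elim: n => [//|n IH]; rewrite !exprS IH moritaME.
by rewrite !tens0r !raddf0 !ract0x !addr0 add0r.
Qed.

Definition offdiag (A B : pzRingType) (M : bimodType A B) (N : bimodType B A)
    (C : moritaContext M N) : set (moritaRing C) :=
  [set x | mx_ul x = 0 /\ mx_dr x = 0].

(** Letters are taken in pairs: two off-diagonal matrices multiply to a diagonal one with entries in
    MN and NM, and diagonal matrices multiply entrywise. *)
Lemma offdiag_prod (A B : pzRingType) (M : bimodType A B) (N : bimodType B A)
    (C : moritaContext M N) (k : nat) (l : seq (moritaRing C)) :
  size l = k.*2 -> (forall x, x \in l -> offdiag x) ->
  exists a b, [/\ \prod_(x <- l) x = MoritaMx C a 0 0 b,
    ideal_exp (MNideal C) k a & ideal_exp (NMideal C) k b].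
Proof.
elim: k l => [|k IH] [|x [|y l]] //=.
  by move=> _ _; exists 1, 1; rewrite big_nil.
move=> [sl] lP; have [z zl|a [b [le Ia Jb]]] := IH l sl.
  by apply: lP; rewrite !inE zl !orbT.
have xP : offdiag x by apply: lP; rewrite inE eqxx.
have yP : offdiag y by apply: lP; rewrite !inE eqxx orbT.
case: x y xP yP {lP} => [_ m n _] [_ m' n' _] [/= -> ->] [/= -> ->].
exists (mc_phi C (m *t n') * a), (mc_psi C (n *t m') * b); split.
- rewrite !big_cons le mulrA !moritaME.
  rewrite !(mul0r, mulr0, scale0r, ractx0, addr0, add0r, tens0r, tens0l).
  by rewrite !(raddf0, ract0x, addr0, add0r).
- by apply: ideal_exp_cons => //; exists (m *t n').
- by apply: ideal_exp_cons => //; exists (n *t m').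
Qed.

(* Every matrix with diagonal in MN and NM is a sum of nonempty products of
   off-diagonal matrices. *)
Lemma offdiag_span (A B : pzRingType) (M : bimodType A B) (N : bimodType B A)
    (C : moritaContext M N) (x : moritaRing C) :
  MNideal C (mx_ul x) -> NMideal C (mx_dr x) ->
  word_span (@offdiag _ _ _ _ C) 1 x.
Proof.
have off m n : word_span (@offdiag _ _ _ _ C) 1 (MoritaMx C 0 m n 0).
  exact: word_span_gen.
case: x => a m n b /= [t _ <-] [u _ <-].
have -> : MoritaMx C (mc_phi C t) m n (mc_psi C u) =
    MoritaMx C (mc_phi C t) 0 0 0 + MoritaMx C 0 m n 0
    + MoritaMx C 0 0 0 (mc_psi C u).
  by rewrite !moritaDE !addr0 !add0r.
apply: WordSpanD; first apply: WordSpanD => //.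
- have [s ->] := tensor_sum t; elim: s => [|p s IH].
    by rewrite big_nil raddf0; apply: WordSpan0.
  rewrite big_cons raddfD.
  (* A pure tensor in the corner is a product of two off-diagonal matrices with one entry each, a
     word of level 2. *)
  have -> : MoritaMx C (mc_phi C (p.1 *t p.2) +
      mc_phi C (\sum_(j <- s) j.1 *t j.2)) 0 0 0 =
      MoritaMx C 0 p.1 0 0 * MoritaMx C 0 0 p.2 0 +
      MoritaMx C (mc_phi C (\sum_(j <- s) j.1 *t j.2)) 0 0 0.
    rewrite moritaME moritaDE !(mul0r, scale0r, ractx0, tens0l, raddf0).
    by rewrite !(addr0, add0r).
  by apply: WordSpanD => //; apply: (@word_span_leq _ _ _ 2) => //;
    apply: (@word_span_mul _ _ 1 1).
- have [s ->] := tensor_sum u; elim: s => [|p s IH].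
    by rewrite big_nil raddf0; apply: WordSpan0.
  rewrite big_cons raddfD.
  have -> : MoritaMx C 0 0 0 (mc_psi C (p.1 *t p.2) +
      mc_psi C (\sum_(j <- s) j.1 *t j.2)) =
      MoritaMx C 0 0 p.1 0 * MoritaMx C 0 p.2 0 0 +
      MoritaMx C 0 0 0 (mc_psi C (\sum_(j <- s) j.1 *t j.2)).
    rewrite moritaME moritaDE !(mul0r, scale0r, ractx0, tens0l, raddf0).
    by rewrite !(addr0, add0r).
  by apply: WordSpanD => //; apply: (@word_span_leq _ _ _ 2) => //;
    apply: (@word_span_mul _ _ 1 1).
Qed.

Lemma morita_nilpotent (A B : pzRingType) (M : bimodType A B)
    (N : bimodType B A) (C : moritaContext M N) (x : moritaRing C) :
  nilpotent_ideal (MNideal C) -> nilpotent_ideal (NMideal C) ->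
  MNideal C (mx_ul x) -> NMideal C (mx_dr x) -> nilpotent_elt x.
Proof.
(* The power [k + k'] kills both ideals; it is doubled because each ideal factor uses two
   letters. *)
move=> [_ [k I0]] [_ [k' J0]] xI xJ; exists (k + k').*2.
apply: (@word_span_zero _ (@offdiag _ _ _ _ C) (k + k').*2); last first.
  exact/word_span_expr/offdiag_span.
(* The word may be longer than required; its prefix of exact length already vanishes. *)
move=> l lP kl; rewrite -(cat_take_drop (k + k').*2 l) big_cat /=.
have [|y /mem_take/lP //|a [b [-> Ia Jb]]] :=
  @offdiag_prod _ _ _ _ C (k + k') (take (k + k').*2 l).
  by rewrite size_takel.
by rewrite (ideal_exp_zero_leq (leq_addr _ _) I0 Ia)
  (ideal_exp_zero_leq (leq_addl _ _) J0 Jb) mul0r.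
Qed.

Lemma mx_ulM_mod (A B : pzRingType) (M : bimodType A B) (N : bimodType B A)
    (C : moritaContext M N) (x y : moritaRing C) :
  MNideal C (mx_ul (x * y) - mx_ul x * mx_ul y).
Proof.
case: x y => a m n b [a' m' n' b']; rewrite moritaME /= addrAC subrr add0r.
by exists (m *t n').
Qed.

Lemma mx_drM_mod (A B : pzRingType) (M : bimodType A B) (N : bimodType B A)
    (C : moritaContext M N) (x y : moritaRing C) :
  NMideal C (mx_dr (x * y) - mx_dr x * mx_dr y).
Proof.
case: x y => a m n b [a' m' n' b']; rewrite moritaME /= addrK.
by exists (n *t m').
Qed.

Theorem theorem5p6 (A B : pzRingType) (M : bimodType A B) (N : bimodType B A)
    (C : moritaContext M N) :
  nilpotent_ideal (MNideal C) -> nilpotent_ideal (NMideal C) ->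
  (weakly_periodic (moritaRing C) <->
   weakly_periodic A /\ weakly_periodic B).
Proof.
move=> nI nJ; split=> [wpR|[wpA wpB] [a m n b]].
  split.
  - apply: (weakly_periodic_image (pi := @mx_ul _ _ _ _ C) nI) wpR => //.
      exact: mx_ulM_mod.
    by move=> a; exists (MoritaMx C a 0 0 0).
  - apply: (weakly_periodic_image (pi := @mx_dr _ _ _ _ C) nJ) wpR => //.
      exact: mx_drM_mod.
    by move=> b; exists (MoritaMx C 0 0 0 b).
have [e [f [[[|[|k]] // _ ek] [i fi] ->]]] := wpA a.
have [e' [f' [[[|[|k']] // _ ek'] [j fj] ->]]] := wpB b.
exists (MoritaMx C e 0 0 e'), (MoritaMx C f m n f'); split.
(* A common exponent for [e] and [e']: congruent to 1 modulo both [k.+1] and [k'.+1]. *)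
- exists (k.+1 * k'.+1).+1; first by rewrite ltnS muln_gt0.
  rewrite morita_diagX; congr MoritaMx; first exact: potent_expr_add.
  by rewrite mulnC; apply: potent_expr_add.
(* Modulo MN and NM the diagonal of this power is f^(i+j), f'^(i+j), and both vanish. *)
- have [h hx] : nilpotent_elt (MoritaMx C f m n f' ^+ (i + j)).
    apply: morita_nilpotent => //.
    + have := expr_morph_mod (MoritaMx C f m n f') (i + j) nI.1 erefl
        (@mx_ulM_mod _ _ _ _ C).
      by rewrite [mx_ul (MoritaMx _ _ _ _ _)]/= [f ^+ _]exprD fi mul0r subr0.
    + have := expr_morph_mod (MoritaMx C f m n f') (i + j) nJ.1 erefl
        (@mx_drM_mod _ _ _ _ C).
      by rewrite [mx_dr (MoritaMx _ _ _ _ _)]/= [f' ^+ _]exprD fj mulr0 subr0.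
  by exists ((i + j) * h)%N; rewrite exprM.
- by rewrite moritaDE !add0r.
Qed.
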